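(* Let $(G,\sigma)$ be a finite connected unbalanced signed graph satisfying $CD^\sigma(0,N)$ for some $N\in(1,\infty]$. Then \[ \mathrm{vol}(G)\leq 8\sqrt{\left(1+\sqrt{(N-1)/N}\right)\ln 2}\cdot d\,\iota^\sigma(G)\sqrt{(D+1)\lceil(D+1)/2\rceil}, \] where $d$ is the maximal vertex degree, $D$ the diameter, $\mathrm{vol}(G)=\sum_{x\in V}d_x$, and $\sqrt{(N-1)/N}:=1$ when $N=\infty$.
   Context: $G=(V,E)$ is a finite simple connected graph with degrees $d_x$; $\sigma:E\to\{\pm1\}$, $\sigma_{xy}=\sigma(\{x,y\})$; $(G,\sigma)$ is balanced if every cycle has sign product $+1$, unbalanced otherwise. The frustration index is $\iota^\sigma(G)=\min_{\tau:V\to\{\pm1\}}\sum_{\{x,y\}\in E}|\tau(x)-\sigma_{xy}\tau(y)|$. Signed Laplacian $\Delta^{\sigma}f(x)=\frac{1}{d_x}\sum_{y\sim x}(\sigma_{xy}f(y)-f(x))$; $\Delta$ is the case $\sigma\equiv+1$. $\Gamma^{\sigma}(f,g)=\frac12\{\Delta(fg)-g\Delta^{\sigma}f-f\Delta^{\sigma}g\}$, $\Gamma_2^{\sigma}(f,g)=\frac12\{\Delta\Gamma^{\sigma}(f,g)-\Gamma^{\sigma}(g,\Delta^{\sigma}f)-\Gamma^{\sigma}(f,\Delta^{\sigma}g)\}$. $CD^{\sigma}(K,N)$ means $\Gamma_2^{\sigma}(f,f)(x)\ge\frac1N(\Delta^\sigma f)^2(x)+K\Gamma^\sigma(f,f)(x)$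 for all $f:V\to\mathbb{R}$, $x\in V$ ($\frac1N=0$ if $N=\infty$). $\lceil\cdot\rceil$ is the ceiling. *)

(* Defs.v *)
From HB Require Import structures.
From mathcomp Require Import all_boot all_order all_algebra.
From mathcomp Require Import reals ereal exp.
Set Implicit Arguments. Unset Strict Implicit. Unset Printing Implicit Defensive.
Import Order.TTheory GRing.Theory Num.Theory.
Local Open Scope ring_scope.

Section SignedGraph.
Variables (R : realType) (T : finType) (adj : rel T) (sigma : T -> T -> R).

Definition deg (x : T) : nat := #|[set y | adj x y]|.

Definition maxdeg : nat := \max_(x : T) deg x.

Definition vol : R := \sum_(x : T) (deg x)%:R.

Definition walk_len (n : nat) (x y : T) : bool :=
  [exists s : n.-tuple T, path adj x s && (last x s == y)].

(* graph distance (defaults to #|T| if unreachable, impossible when connected) *)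
Definition dist (x y : T) : nat :=
  \big[minn/#|T|]_(n < #|T| | walk_len n x y) (n : nat).

Definition diam : nat := \max_(x : T) \max_(y : T) dist x y.

Definition cycle_sign (s : seq T) : R :=
  \prod_(e <- zip s (rot 1 s)) sigma e.1 e.2.

Definition balanced : Prop :=
  forall s : seq T, cycle adj s -> uniq s -> (3 <= size s)%N -> cycle_sign s = 1.

Definition sgn (b : bool) : R := if b then 1 else -1.

(* sum over edges {x,y} of |tau x - sigma_xy tau y|; each edge is counted
   twice in the ordered double sum, hence the factor 1/2 *)
Definition frust_cost (tau : {ffun T -> bool}) : R :=
  2^-1 * \sum_(x : T) \sum_(y : T | adj x y) `|sgn (tau x) - sigma x y * sgn (tau y)|.

Definition frustration : R :=
  \big[Num.min/frust_cost [ffun=> true]]_(tau : {ffun T -> bool}) frust_cost tau.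

Definition lapS (f : T -> R) (x : T) : R :=
  (deg x)%:R^-1 * \sum_(y : T | adj x y) (sigma x y * f y - f x).

Definition lap (f : T -> R) (x : T) : R :=
  (deg x)%:R^-1 * \sum_(y : T | adj x y) (f y - f x).

Definition GammaS (f g : T -> R) (x : T) : R :=
  2^-1 * (lap (fun z => f z * g z) x - g x * lapS f x - f x * lapS g x).

Definition Gamma2S (f g : T -> R) (x : T) : R :=
  2^-1 * (lap (GammaS f g) x - GammaS g (lapS f) x - GammaS f (lapS g) x).

Definition invN (N : \bar R) : R :=
  match N with EFin n => n^-1 | _ => 0 end.

Definition CD (K : R) (N : \bar R) : Prop :=
  forall (f : T -> R) (x : T),
    invN N * (lapS f x) ^+ 2 + K * GammaS f f x <= Gamma2S f f x.

End SignedGraph.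

Definition sqrtfac (R : realType) (N : \bar R) : R :=
  match N with EFin n => Num.sqrt ((n - 1) / n) | _ => 1 end.

(* Main.v *)
Require Import Defs.
From HB Require Import structures.
From mathcomp Require Import boolp classical_sets topology normedtype sequences derive.
From mathcomp Require Import all_boot all_order all_algebra.
From mathcomp Require Import reals ereal exp.
From mathcomp Require Import ring lra.
Set Implicit Arguments. Unset Strict Implicit. Unset Printing Implicit Defensive.
Import Order.TTheory GRing.Theory Num.Theory.
Import numFieldNormedType.Exports.
Local Open Scope ring_scope.

(** Let [lam] be the smallest eigenvalue of [- lapS] and [f] an eigenfunction.
    The maximum principle and the curvature condition give
    [Gamma f <= 2 (1 + s) lam max f^2].  As the graph is unbalanced, some walk of
    length at most [D + 1] from a maximum point of [|f|] transports [f] to a value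
    of the opposite sign, and integrating the gradient bound along it yields
    [1 <= 4 (1 + s) d lam (D + 1) ceil ((D + 1) / 2)].

    For a switching [tau], the signed heat flow [P_t] satisfies
    [2 t Gamma (P_t tau) <= 1] by CD(0, oo), so integrating the energy in time gives
    [vol - <P_t tau, tau> <= 2 frust_cost tau sqrt (d t)], whereas
    [<P_t tau, tau> <= exp (- lam t) vol].  At [t = ln 2 / lam] this reads
    [vol <= 4 frust_cost tau sqrt (d t)].  The heat flow is replaced by the explicit
    Euler scheme [(1 + (t / m) lapS)^m], whose error terms are O(1/m). *)

(** * Carré du champ, Dirichlet energy and summation by parts for the signed Laplacian *)

Section Calculus.
Variables (R : realType) (T : finType) (adj : rel T) (sigma : T -> T -> R).
Hypothesis adj_sym : symmetric adj.
Hypothesis sigma_sym : forall x y, sigma x y = sigma y x.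
Hypothesis sigma_pm1 : forall x y, adj x y -> sigma x y = 1 \/ sigma x y = -1.

Local Notation d x := ((deg adj x)%:R : R).
Local Notation Gam := (GammaS adj sigma).
Local Notation L := (lapS adj sigma).

(** The Dirichlet form of [lapS] for the degree-weighted product [inner]; [2^-1] corrects for each
    edge being met from both ends. *)
Definition energy (f g : T -> R) : R :=
  2^-1 * \sum_x \sum_(y | adj x y) (f x - sigma x y * f y) * (g x - sigma x y * g y).

Definition inner (f g : T -> R) : R := \sum_x d x * (f x * g x).

Lemma sigma_sqr x y : adj x y -> sigma x y * sigma x y = 1.
Proof. by move=> /sigma_pm1[]->; rewrite ?mulrNN mulr1. Qed.

Lemma sum_adj_const x (c : R) : \sum_(y | adj x y) c = d x * c.
Proof.
by rewrite sumr_const mulr_natl /deg cardsE.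
Qed.

Lemma deg_eq0_adj x y : d x = 0 -> adj x y = false.
Proof.
move=> /eqP; rewrite pnatr_eq0 => /eqP/cards0_eq h.
by have := in_set0 y; rewrite -h inE.
Qed.

(** As [sigma^2 = 1] on edges, the unsigned term [f y * g y] of [lap] completes the signed terms to
    a product of covariant differences. *)
Lemma GammaE f g x : Gam f g x =
  2^-1 * ((d x)^-1 * \sum_(y | adj x y) (f x - sigma x y * f y) * (g x - sigma x y * g y)).
Proof.
rewrite /GammaS /lap /lapS; congr (_ * _).
rewrite !(mulrCA _ (d x)^-1) -!mulrBr; congr (_ * _).
rewrite !mulr_sumr -!sumrB; apply: eq_bigr => y axy.
have := sigma_sqr axy; set s := sigma x y => h.
have -> : (f x - s * f y) * (g x - s * g y) =
  f x * g x - s * (f y * g x + f x * g y) + (s * s) * (f y * g y) by ring.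
by rewrite h; ring.
Qed.

Lemma Gamma_ge0 f x : 0 <= Gam f f x.
Proof.
rewrite GammaE mulr_ge0 ?invr_ge0 ?ler0n// mulr_ge0 ?invr_ge0 ?ler0n//.
by apply: sumr_ge0 => y _; rewrite -expr2 sqr_ge0.
Qed.

Lemma sum_sqr_Gamma f x :
  \sum_(y | adj x y) (f x - sigma x y * f y) ^+ 2 = 2 * (d x * Gam f f x).
Proof.
rewrite GammaE; have [h|h] := eqVneq (d x) 0.
  by rewrite h mul0r mulr0 big1// => y; rewrite deg_eq0_adj.
under [in RHS]eq_bigr do rewrite -expr2.
by rewrite (mulrCA (d x)) !mulVKf// pnatr_eq0.
Qed.

Lemma sqr_diff_Gamma f x y : adj x y ->
  (f x - sigma x y * f y) ^+ 2 <= 2 * (d x * Gam f f x).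
Proof.
move=> axy; rewrite -sum_sqr_Gamma (bigD1 y)//= lerDl.
by apply: sumr_ge0 => z _; rewrite sqr_ge0.
Qed.

Lemma sum_sqr_diff_Gamma f x y z : adj x y -> adj x z -> y != z ->
  (f x - sigma x y * f y) ^+ 2 + (f x - sigma x z * f z) ^+ 2
   <= 2 * (d x * Gam f f x).
Proof.
move=> axy axz yz; rewrite -sum_sqr_Gamma (bigD1 y)//= lerD2l.
rewrite (bigD1 z)/=; last by rewrite axz eq_sym.
by rewrite lerDl; apply: sumr_ge0 => w _; rewrite sqr_ge0.
Qed.

Lemma energyC f g : energy f g = energy g f.
Proof.
by rewrite /energy; congr (_ * _); apply: eq_bigr => x _; apply: eq_bigr => y _; rewrite mulrC.
Qed.

Lemma deg_lapS f x : d x * L f x = \sum_(y | adj x y) (sigma x y * f y - f x).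
Proof.
rewrite /lapS; have [h|h] := eqVneq (d x) 0.
  by rewrite h mul0r big1// => y; rewrite deg_eq0_adj.
by rewrite mulrA mulfV// mul1r.
Qed.

(* Summation by parts: swapping the endpoints of an edge multiplies [f x - sigma f y] by [- sigma]. *)
Lemma energy_lapS f g : energy f g = - inner f (L g).
Proof.
rewrite /energy /inner.
under [in RHS]eq_bigr do rewrite mulrCA deg_lapS mulr_sumr.
have -> : \sum_x \sum_(y | adj x y) (f x - sigma x y * f y) * (g x - sigma x y * g y)
  = \sum_x \sum_(y | adj x y) f x * (g x - sigma x y * g y)
   + \sum_x \sum_(y | adj x y) (- sigma x y * f y) * (g x - sigma x y * g y).
  rewrite -big_split; apply: eq_bigr => x _; rewrite -big_split.
  by apply: eq_bigr => y _ /=; rewrite -mulrDl mulNr.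
have -> : \sum_x \sum_(y | adj x y) (- sigma x y * f y) * (g x - sigma x y * g y) =
   \sum_x \sum_(y | adj x y) f x * (g x - sigma x y * g y).
  under eq_bigr do rewrite big_mkcond.
  rewrite exchange_big; apply: eq_bigr => x _; rewrite [RHS]big_mkcond; apply: eq_bigr => y _ /=.
  rewrite adj_sym; case: ifP => // axy; rewrite (sigma_sym y x).
  have -> : - sigma x y * f x * (g y - sigma x y * g x) =
    f x * ((sigma x y * sigma x y) * g x - sigma x y * g y) by ring.
  by rewrite sigma_sqr// mul1r.
set S := \sum_x _; rewrite (_ : 2^-1 * (S + S) = S); last by field.
rewrite /S -sumrN; clear S.
apply: eq_bigr => x _; rewrite -sumrN; apply: eq_bigr => y _; ring.
Qed.

Lemma innerC f g : inner f g = inner g f.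
Proof. by apply: eq_bigr => x _; rewrite (mulrC (f x)). Qed.

Lemma inner_ge0 f : 0 <= inner f f.
Proof. by apply: sumr_ge0 => x _; rewrite mulr_ge0 ?ler0n// -expr2 sqr_ge0. Qed.

Lemma energy_ge0 f : 0 <= energy f f.
Proof.
rewrite mulr_ge0 ?invr_ge0 ?ler0n//; apply: sumr_ge0 => x _.
by apply: sumr_ge0 => y _; rewrite -expr2 sqr_ge0.
Qed.

Lemma energy_Gamma f : energy f f = \sum_x d x * Gam f f x.
Proof.
rewrite /energy mulr_sumr; apply: eq_bigr => x _.
under eq_bigr do rewrite -expr2.
by rewrite sum_sqr_Gamma mulKf ?pnatr_eq0.
Qed.

Lemma energy0_eq f : energy f f = 0 -> forall x y, adj x y -> f x = sigma x y * f y.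
Proof.
move=> e0 x y axy; apply/eqP; rewrite -subr_eq0 -sqrf_eq0.
have h1 : \sum_x \sum_(y | adj x y) (f x - sigma x y * f y) ^+ 2 = 0.
  move: e0; rewrite /energy => /eqP; rewrite mulf_eq0 invr_eq0 pnatr_eq0/=.
  by move=> /eqP h; rewrite -[RHS]h; apply: eq_bigr => z _; apply: eq_bigr => w _; rewrite expr2.
move: h1 => /eqP; rewrite psumr_eq0; last first.
  by move=> z _; apply: sumr_ge0 => w _; rewrite sqr_ge0.
move=> /allP/(_ x (mem_index_enum _))/=; rewrite psumr_eq0; last first.
  by move=> w _; rewrite sqr_ge0.
by move=> /allP/(_ y (mem_index_enum _)); rewrite axy.
Qed.

Lemma sqr_sum_le_adj x (u : T -> R) :
  (\sum_(y | adj x y) u y) ^+ 2 <= d x * \sum_(y | adj x y) u y ^+ 2.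
Proof.
have [h|h] := eqVneq (d x) 0.
  by rewrite h mul0r big1 ?expr0n//= => y; rewrite deg_eq0_adj.
have dp : 0 < d x by rewrite lt0r h ler0n.
set S := \sum_(y | _) u y.
have h2 : 0 <= \sum_(y | adj x y) (d x * u y - S) ^+ 2.
  by apply: sumr_ge0 => y _; rewrite sqr_ge0.
have e : \sum_(y | adj x y) (d x * u y - S) ^+ 2 =
   d x * (d x * \sum_(y | adj x y) u y ^+ 2 - S ^+ 2).
  rewrite (eq_bigr (fun y => d x ^+ 2 * u y ^+ 2 + ((- 2 * d x * S) * u y + S ^+ 2))).
    2: by move=> y _; ring.
  rewrite !big_split/= -!mulr_sumr sum_adj_const -/S; ring.
by move: h2; rewrite e pmulr_rge0// subr_ge0.
Qed.

Lemma lapS_sqr_le f x : L f x ^+ 2 <= 2 * Gam f f x.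
Proof.
rewrite GammaE mulVKf ?pnatr_eq0//.
have [h|h] := eqVneq (d x) 0.
  by rewrite /lapS h invr0 !mul0r expr0n.
have dp : 0 < d x by rewrite lt0r h ler0n.
rewrite -(ler_pM2l (exprn_gt0 2 dp)) -exprMn deg_lapS.
rewrite (_ : d x ^+ 2 * _ = d x * \sum_(y | adj x y) (sigma x y * f y - f x) ^+ 2); last first.
  by rewrite expr2 -mulrA mulVKf//; congr (_ * _); apply: eq_bigr => y _; ring.
exact: sqr_sum_le_adj.
Qed.

(** In spectral terms, [- lapS] has no eigenvalue above 2; this absorbs the quadratic term of an
    Euler step. *)
Lemma lapS_inner_le f : inner (L f) (L f) <= 2 * energy f f.
Proof.
rewrite energy_Gamma mulr_sumr; apply: ler_sum => x _.
by rewrite -expr2 (mulrCA 2) ler_wpM2l ?ler0n ?lapS_sqr_le.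
Qed.

Lemma lap_sqr f x : lap adj (fun z => f z * f z) x = 2 * Gam f f x + 2 * (f x * L f x).
Proof. by rewrite /GammaS; field. Qed.

(** Maximum principle with slack: [c = 0] serves at a maximum point, general [c] controls one Euler
    step. *)
Lemma lap_le (f : T -> R) c x : (forall y, f y <= f x + c) -> 0 <= c -> lap adj f x <= c.
Proof.
move=> h c0; rewrite /lap; have [e|e] := eqVneq (d x) 0; first by rewrite e invr0 mul0r.
have dp : 0 < d x by rewrite lt0r e ler0n.
rewrite ler_pdivrMl// -sum_adj_const; apply: ler_sum => y _; rewrite lerBlDl; exact: h.
Qed.

End Calculus.

(** * Ground state of [- lapS] by minimising the Rayleigh quotient *)

Section GroundState.
Variables (R : realType) (T : finType) (adj : rel T) (sigma : T -> T -> R).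
Hypothesis adj_sym : symmetric adj.
Hypothesis sigma_sym : forall x y, sigma x y = sigma y x.
Hypothesis sigma_pm1 : forall x y, adj x y -> sigma x y = 1 \/ sigma x y = -1.
Hypothesis deg_gt0 : forall x, (0 < deg adj x)%N.

Local Notation L := (lapS adj sigma).
Local Notation energy := (energy adj sigma).
Local Notation inner := (@inner R T adj).

Lemma inner0_eq f : inner f f = 0 -> forall x, f x = 0.
Proof.
move=> /eqP; rewrite psumr_eq0; last first.
  by move=> x _; rewrite mulr_ge0 ?ler0n// -expr2 sqr_ge0.
move=> /allP h x; have := h x (mem_index_enum _).
by rewrite /= !mulf_eq0 pnatr_eq0 -leqn0 leqNgt deg_gt0/= orbb => /eqP.
Qed.

Lemma innerZ c f : inner (fun x => c * f x) (fun x => c * f x) = c ^+ 2 * inner f f.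
Proof. by rewrite /inner mulr_sumr; apply: eq_bigr => x _; ring. Qed.

Lemma energyZ c f : energy (fun x => c * f x) (fun x => c * f x) = c ^+ 2 * energy f f.
Proof.
rewrite /energy mulrCA; congr (_ * _); rewrite mulr_sumr; apply: eq_bigr => x _.
by rewrite mulr_sumr; apply: eq_bigr => y _; ring.
Qed.

Lemma innerD e f g : inner (fun x => f x + e * g x) (fun x => f x + e * g x) =
  inner f f + 2 * e * inner f g + e ^+ 2 * inner g g.
Proof.
rewrite /inner !mulr_sumr -!big_split/=; apply: eq_bigr => x _; ring.
Qed.

Lemma energyD e f g : energy (fun x => f x + e * g x) (fun x => f x + e * g x) =
  energy f f + 2 * e * energy f g + e ^+ 2 * energy g g.
Proof.
rewrite /energy !(mulrCA _ 2^-1) -!mulrDr; congr (_ * _).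
rewrite !mulr_sumr -!big_split/=; apply: eq_bigr => x _.
rewrite !mulr_sumr -!big_split/=; apply: eq_bigr => y _; ring.
Qed.

Lemma energy_eq f f' g g' : f =1 f' -> g =1 g' -> energy f g = energy f' g'.
Proof.
move=> h k; rewrite /energy; congr (_ * _); apply: eq_bigr => x _; apply: eq_bigr => y _.
by rewrite !h !k.
Qed.

Lemma inner_eq f f' g g' : f =1 f' -> g =1 g' -> inner f g = inner f' g'.
Proof. by move=> h k; apply: eq_bigr => x _; rewrite h k. Qed.

Lemma continuous_sum (U : topologicalType) (I : finType) (P : pred I) (F : I -> U -> R) :
  (forall i, continuous (F i)) -> continuous (fun u => \sum_(i | P i) F i u).
Proof.
move=> h; apply: continuous_big => //; exact: add_continuous.
Qed.

Lemma rayleigh_min (x0 : T) : exists f, inner f f = 1 /\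
  forall g, inner g g = 1 -> energy f f <= energy g g.
Proof.
(* Functions on [T] are recorded as row vectors, whose topology supplies compactness of the unit
   sphere. *)
pose fn (v : 'rV[R]_#|T|) x : R := v ord0 (enum_rank x).
pose S := [set v | inner (fn v) (fn v) = 1]%classic.
have cc x : continuous (fun v => fn v x) by move=> v; exact: coord_continuous.
have cI : continuous (fun v => inner (fn v) (fn v)).
  apply: continuous_sum => x v; exact: (cvgM (cvg_cst _) (cvgM (cc x v) (cc x v))).
have cE : continuous (fun v => energy (fn v) (fn v)).
  have cs : continuous (fun v => \sum_x \sum_(y | adj x y)
      (fn v x - sigma x y * fn v y) * (fn v x - sigma x y * fn v y)).
    apply: continuous_sum => x; apply: continuous_sum => y v.
    have h := cvgB (cc x v) (cvgM (cvg_cst (sigma x y)) (cc y v)).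
    exact: (cvgM (h _ _ _) (h _ _ _)).
  by move=> v; exact: (cvgM (cvg_cst _) (cs v)).
have fnK g : fn (\row_i g (enum_val i)) =1 g.
  by move=> x; rewrite /fn mxE enum_rankK.
have S0 : (S !=set0)%classic.
  have p0 : 0 < inner (fun=> 1) (fun=> 1).
    rewrite lt0r inner_ge0 andbT; apply/eqP => /inner0_eq /(_ x0) /eqP.
    by rewrite oner_eq0.
  exists (\row_i ((Num.sqrt (inner (fun=> 1) (fun=> 1)))^-1 * 1)); rewrite /S/=.
  rewrite (@inner_eq _ (fun x => (Num.sqrt (inner (fun=> 1) (fun=> 1)))^-1 * 1) _ (fun x => (Num.sqrt (inner (fun=> 1) (fun=> 1)))^-1 * 1)); last 2 first.
  - by move=> x; rewrite /fn mxE.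
  - by move=> x; rewrite /fn mxE.
  by rewrite (innerZ _ (fun=> 1)) exprVn sqr_sqrtr ?(ltW p0)// mulVf// gt_eqF.
have Sc : compact S.
  apply: (@subclosed_compact _ _ [set v : 'rV[R]_#|T| | forall i, `[(-1 : R), 1]%classic (v ord0 i)]%classic).
  - exact: ((continuous_closedP _).1 cI _ (@closed_eq _ 1)).
  - exact: (@rV_compact R #|T| (fun=> `[(-1 : R), 1]%classic) (fun=> @segment_compact R (-1) 1)).
  (* The cube contains the sphere because degrees are at least 1, so that
     [f x ^+ 2 <= inner f f]. *)
  - move=> v; rewrite /S/= => h i; rewrite in_itv/= -ler_norml.
    rewrite -(@expr_le1 _ 2)// -normrX ger0_norm ?sqr_ge0// -h /inner (bigD1 (enum_val i))//=.
    have -> : v ord0 i = fn v (enum_val i) by rewrite /fn enum_valK.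
    apply: ler_wpDr.
      by apply: sumr_ge0 => x _; rewrite mulr_ge0 ?ler0n// -expr2 sqr_ge0.
    by rewrite -expr2 ler_peMl ?sqr_ge0// ler1n.
have [v vS vmin] := compact_EVT_min S0 Sc (continuous_subspaceT cE).
exists (fn v); split; first exact: (set_mem vS).
move=> g g1; rewrite -(energy_eq (fnK g) (fnK g)); apply/vmin/mem_set; rewrite /S/=.
by rewrite (inner_eq (fnK g) (fnK g)).
Qed.

(** Testing against a point mass turns the weak eigenvalue equation into the pointwise one. *)
Lemma inner_delta f x : inner (fun z => (z == x)%:R) f = (deg adj x)%:R * f x.
Proof.
rewrite /inner (bigD1 x)//= eqxx mul1r big1 ?addr0// => y /negbTE ->.
by rewrite mul0r mulr0.
Qed.

Lemma ground_state (x0 : T) : exists lam f,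
  [/\ inner f f = 1, (forall x, L f x = - lam * f x), energy f f = lam &
      forall g, lam * inner g g <= energy g g].
Proof.
have [f [f1 fmin]] := rayleigh_min x0.
have ray g : energy f f * inner g g <= energy g g.
  have [g0|g0] := eqVneq (inner g g) 0.
    by rewrite g0 mulr0 energy_ge0.
  have gp : 0 < inner g g by rewrite lt0r g0 inner_ge0.
  rewrite -ler_pdivlMr// mulrC.
  have e : (Num.sqrt (inner g g))^-1 ^+ 2 = (inner g g)^-1.
    by rewrite exprVn sqr_sqrtr ?ltW.
  rewrite -e -energyZ; apply: fmin.
  by rewrite innerZ e mulVf.
exists (energy f f), f; split=> // x.
pose g := fun z => (z == x)%:R : R.
set lam := energy f f in ray *.
(* Along [f + e * g], the quantity [energy - lam * inner] equals [2 * e * B + e ^+ 2 * C]; its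
   minimum 0 at [e = 0] forces [B = 0]. *)
pose B := energy f g - lam * inner f g.
pose C := energy g g - lam * inner g g.
have q e : 0 <= 2 * e * B + e ^+ 2 * C.
  have := ray (fun z => f z + e * g z).
  rewrite innerD energyD f1 -/lam -subr_ge0 /B /C.
  by set u := (X in 0 <= X) => h; set w := (X in 0 <= X); rewrite (_ : w = u)//; rewrite /w /u; ring.
have C0 : 0 <= C by rewrite /C subr_ge0.
have B0 : B = 0.
  clearbody B C.
  (* Nearly the minimiser [- B / C], with [+ 1] guarding against [C = 0]; clearing denominators
     leaves [- (B ^+ 2 * (C + 2))]. *)
  have h1 := q (- B / (C + 1)).
  have c1 : 0 < C + 1 by lra.
  have : 0 <= (C + 1) ^+ 2 * (2 * (- B / (C + 1)) * B + (- B / (C + 1)) ^+ 2 * C).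
    by rewrite mulr_ge0 ?sqr_ge0.
  rewrite [X in 0 <= X](_ : _ = - (B ^+ 2 * (C + 2))); last by field; rewrite gt_eqF.
  rewrite oppr_ge0 => h2; apply/eqP; rewrite -sqrf_eq0 eq_le sqr_ge0 andbT.
  by move: h2; rewrite pmulr_lle0//; lra.
have dn : (deg adj x)%:R != 0 :> R by rewrite pnatr_eq0 -lt0n.
apply: (mulfI dn); rewrite (mulrCA _ (- lam)) -!inner_delta -/g.
move: B0; rewrite /B energyC energy_lapS// (innerC adj f g) => /eqP.
by rewrite subr_eq0 => /eqP h; rewrite mulNr -h opprK.
Qed.

End GroundState.

(** * Gradient estimate for eigenfunctions *)

Section GradientEstimate.
Variables (R : realType) (T : finType) (adj : rel T) (sigma : T -> T -> R).
Hypothesis adj_sym : symmetric adj.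
Hypothesis sigma_sym : forall x y, sigma x y = sigma y x.
Hypothesis sigma_pm1 : forall x y, adj x y -> sigma x y = 1 \/ sigma x y = -1.

Local Notation Gam := (GammaS adj sigma).
Local Notation L := (lapS adj sigma).

Lemma lap_linear (u v : T -> R) c x :
  lap adj (fun z => u z + c * v z) x = lap adj u x + c * lap adj v x.
Proof.
rewrite /lap mulrCA -mulrDr; congr (_ * _).
rewrite mulr_sumr -big_split; apply: eq_bigr => y _ /=; ring.
Qed.

Lemma Gamma_eigen lam f x : (forall x, L f x = - lam * f x) ->
  Gam f (L f) x = - lam * Gam f f x.
Proof.
move=> eig; rewrite !GammaE// !(mulrCA (- lam)); congr (_ * (_ * _)).
by rewrite mulr_sumr; apply: eq_bigr => y _; rewrite !eig; ring.
Qed.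

(* Maximum principle for [Gam f f + (1 + s) * lam * f^2]; the identity [s^2 = 1 - i]
   makes the coefficient [1 + s] optimal. *)
Lemma gradient_estimate (lam : R) f (i s M : R) :
  0 <= lam -> (forall x, L f x = - lam * f x) -> energy adj sigma f f = lam ->
  0 < s -> s ^+ 2 = 1 - i ->
  (forall x, i * L f x ^+ 2 <= Gamma2S adj sigma f f x) ->
  (forall x, f x ^+ 2 <= M) ->
  forall x, Gam f f x <= 2 * (1 + s) * lam * M.
Proof.
rewrite le_eqVlt => /orP[/eqP <-|lam0] eig en s0 s2 cd fM x.
  (* Case [lam = 0]: the energy vanishes, so [f] is parallel along every edge. The main case has to
     cancel a factor [lam]. *)
  rewrite mulr0 mul0r GammaE// big1 ?mulr0// => y axy.
  by rewrite -(energy0_eq en axy) subrr mul0r.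
pose F z := Gam f f z + ((1 + s) * lam) * (f z * f z).
have [x1 _ Fx1] := @Order.TotalTheory.arg_maxP _ _ _ x predT F isT.
have lapF : lap adj F x1 <= 0 by apply: lap_le => // y; rewrite addr0; exact: Fx1.
have Gx1 : Gam f f x1 <= (1 + s) * lam * (f x1 ^+ 2).
  move: lapF; rewrite lap_linear (lap_sqr _ sigma) eig.
  have := cd x1; rewrite /Gamma2S (Gamma_eigen _ eig) eig.
  rewrite (_ : i = 1 - s ^+ 2); last by rewrite s2; ring.
  set G := Gam f f x1; set A := lap adj (Gam f f) x1; set u := f x1 => h1 h2.
  (* Eliminating [A] between the curvature inequality and [lap F <= 0] leaves this product, since
     [(1 + s) - (1 - s^2) = s * (1 + s)]. *)
  have : 0 <= (2 * lam * s) * ((1 + s) * lam * u ^+ 2 - G).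
    by move: h1 h2; clearbody G A u; nra.
  by rewrite pmulr_rge0 ?subr_ge0// !mulr_gt0.
have F0 y : Gam f f y <= F y.
  by rewrite /F lerDl -expr2 mulr_ge0 ?sqr_ge0// mulr_ge0//; lra.
apply: (le_trans (F0 x)); apply: (le_trans (Fx1 x isT)).
(* Both summands of [F x1] are at most [(1 + s) * lam * f x1 ^+ 2], whence the factor 2. *)
apply: (@le_trans _ _ (2 * (1 + s) * lam * f x1 ^+ 2)).
  by rewrite /F; move: Gx1; lra.
by rewrite ler_wpM2l// !mulr_ge0//; lra.
Qed.

End GradientEstimate.

(** * Parallel transport along walks, and the sign change forced by unbalance *)

Section Walks.
Variables (R : realType) (T : finType) (adj : rel T) (sigma : T -> T -> R).
Hypothesis adj_sym : symmetric adj.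
Hypothesis sigma_sym : forall x y, sigma x y = sigma y x.
Hypothesis sigma_pm1 : forall x y, adj x y -> sigma x y = 1 \/ sigma x y = -1.
Hypothesis connected : forall x y : T, connect adj x y.

Local Notation Gam := (GammaS adj sigma).

(** Holonomy of the walk: the value at the last vertex is transported back to [x] by this sign. *)
Fixpoint walk_sign (x : T) (p : seq T) : R :=
  if p is y :: p' then sigma x y * walk_sign y p' else 1.

Fixpoint walk_energy (f : T -> R) (x : T) (p : seq T) : R :=
  if p is y :: p' then (f x - sigma x y * f y) ^+ 2 + walk_energy f y p' else 0.

(** Absence of backtracking: no three consecutive vertices [x], [y], [x]. *)
Fixpoint reduced (x : T) (p : seq T) : bool :=
  if p is y :: p' then (if p' is z :: _ then x != z else true) && reduced y p' else true.

Lemma walk_sign_rcons x p y :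
  walk_sign x (rcons p y) = walk_sign x p * sigma (last x p) y.
Proof. by elim: p x => [|z p IH] x /=; rewrite ?mulr1 ?mul1r// IH mulrA. Qed.

(** Cauchy-Schwarz for the telescoped transport, each edge difference being multiplied by a sign
    only. *)
Lemma walk_diff_sqr_le f x p : path adj x p ->
  (f x - walk_sign x p * f (last x p)) ^+ 2 <= (size p)%:R * walk_energy f x p.
Proof.
elim: p x => [|y p IH] x /=; first by rewrite mul1r subrr expr0n mul0r.
case/andP=> axy /IH; set v := walk_sign y p * _; set S := walk_energy f y p => h.
have -> : f x - sigma x y * walk_sign y p * f (last y p) =
    (f x - sigma x y * f y) + sigma x y * (f y - v) by rewrite /v; ring.
set a := f x - _; set b := sigma x y * _.
have b2 : b ^+ 2 <= (size p)%:R * S.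
  by rewrite /b exprMn expr2 (sigma_sqr sigma_pm1)// mul1r.
have n0 : 0 <= (size p)%:R :> R by rewrite ler0n.
rewrite -natr1; move: b2 n0; set n : R := (size p)%:R => b2.
rewrite le_eqVlt => /orP[/eqP n0|n0].
  move: b2; rewrite -n0 mul0r => b2.
  have /eqP : b ^+ 2 = 0 by apply/eqP; rewrite eq_le b2 sqr_ge0.
  rewrite sqrf_eq0 => /eqP ->; rewrite addr0 add0r mul1r lerDl.
  by rewrite /S; elim: (p) (y) => //= z q IHq w; rewrite addr_ge0// sqr_ge0.
rewrite -(ler_pM2l n0).
(* After multiplication by [n], the two sides differ by at least this square. *)
have := sqr_ge0 (n * a - b); nra.
Qed.

Lemma diff_sqrC f x y : adj x y ->
  (f x - sigma x y * f y) ^+ 2 = (f y - sigma y x * f x) ^+ 2.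
Proof.
move=> axy; rewrite (sigma_sym y x).
by case: (sigma_pm1 axy) => ->; ring.
Qed.

(* In a reduced walk, two consecutive edges are controlled by [Gam] at their common vertex. *)
Lemma walk_energy_le f G x p : 0 <= G ->
  (forall x, 2 * ((deg adj x)%:R * Gam f f x) <= G) ->
  path adj x p -> reduced x p -> walk_energy f x p <= (uphalf (size p))%:R * G.
Proof.
(* Strong induction on the length: edges are removed in pairs, and a single leftover edge costs a
   whole [G], whence the rounding up. *)
move=> G0 hG; have [n] := ubnP (size p); elim: n x p => // n IH x [|y [|z p]] /=.
- by rewrite mul0r.
- rewrite andbT addr0 mul1r => _ axy _.
  exact: le_trans (sqr_diff_Gamma sigma_pm1 f axy) (hG x).
- rewrite !ltnS => sp /and3P[axy ayz pp] /and3P[xz _ rp].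
  rewrite addrA -[(_.+1)%:R]natr1 mulrDl mul1r addrC lerD//.
    by apply: IH => //; apply: ltnW.
  rewrite (diff_sqrC f axy); apply: le_trans (hG y).
  by apply: (sum_sqr_diff_Gamma sigma_pm1) => //; rewrite adj_sym.
Qed.

(** Cutting out a backtrack shortens the walk and keeps its sign, the edge contributing
    [sigma^2 = 1]. *)
Lemma reduced_walk x p : path adj x p -> exists q,
  [/\ path adj x q, reduced x q, (size q <= size p)%N, last x q = last x p &
      walk_sign x q = walk_sign x p].
Proof.
elim: p x => [|y p IH] x /=; first by exists [::].
case/andP=> axy /IH [[|z q]] /= [pq rq sq lq wq].
  by exists [:: y]; rewrite /= axy; split=> //; rewrite wq.
have [xz|xz] := eqVneq x z; last first.
  by exists [:: y, z & q]; rewrite /= axy xz wq; split.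
exists q; rewrite xz; case/andP: pq => ayz pq; case/andP: rq => _ rq; split=> //.
  by apply: leq_trans (leqnSn _); apply: leq_trans sq.
by rewrite -wq mulrA (sigma_sym z y) (sigma_sqr sigma_pm1)// mul1r.
Qed.

(** The signs of [u] switch [sigma] to the trivial signature: [sigma x y] is the product of the
    signs of [u x] and [u y], so cycle products telescope to 1. *)
Lemma positive_switching_balanced (u : T -> R) :
  (forall x y, adj x y -> 0 < sigma x y * (u x * u y)) -> balanced adj sigma.
Proof.
move=> hu.
have sE x y : adj x y -> sigma x y = Num.sg (u x) * Num.sg (u y).
  move=> axy; have := hu _ _ axy; rewrite -sgrM.
  case: (sigma_pm1 axy) => ->; rewrite ?mul1r ?mulN1r ?oppr_gt0 => h.
    by rewrite gtr0_sg.
  by rewrite ltr0_sg.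
have sq x y : adj x y -> Num.sg (u x) * Num.sg (u x) = 1.
  move=> axy; rewrite -expr2 sqr_sg; have := hu _ _ axy.
  by case: (eqVneq (u x) 0) => // ->; rewrite mul0r mulr0 ltxx.
have key x p z : path adj x (rcons p z) ->
  \prod_(e <- zip (x :: p) (rcons p z)) sigma e.1 e.2 = Num.sg (u x) * Num.sg (u z).
  elim: p x => [|y p IH] x /=; first by rewrite andbT big_seq1; apply: sE.
  case/andP=> axy pp; rewrite big_cons IH//= sE// -mulrA (mulrA (Num.sg (u y))).
  by rewrite (sq y x) ?mul1r// adj_sym.
move=> [|x p]//= cyc _ _.
rewrite /cycle_sign rot1_cons key//.
case: p cyc => [|y p] /=; first by rewrite andbT => /sq.
by case/andP=> /sq.
Qed.

Lemma walk_le_diam x y : exists p,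
  [/\ path adj x p, last x p = y & (size p <= diam adj)%N].
Proof.
have /connectP[p pp ->] := connected x y.
have [p' pp' up' _] := shortenP pp; set y' := last x p'.
have sp' : (size p' < #|T|)%N.
  by rewrite -[(size p').+1]/(size (x :: p')) -(card_uniqP up') max_card.
(* When the minimum defining [dist] is its default [#|T|], the simple path [p'] is a witness; hence
   only length at most [dist] is asked for. *)
suff [j [jd /existsP[s /andP[ps /eqP ls]]]] : exists j, (j <= dist adj x y')%N /\ walk_len adj j x y'.
  exists s; split=> //; rewrite size_tuple; apply: leq_trans jd _.
  by apply: leq_trans (leq_bigmax x); apply: (@leq_bigmax _ (fun y => dist adj x y)).
rewrite /dist; elim/big_rec: _ => [|i k wi [j [jk wj]]].
  exists (size p'); split; first exact: ltnW.
  by apply/existsP; exists (in_tuple p'); rewrite pp' /=.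
by rewrite /minn; case: ifP => _; [exists i | exists j].
Qed.

(** Otherwise a walk of length at most [D] to [x] and its extension by an edge [x y] both transport
    positively. Their product is a square times [sigma x y * (f x * f y)], so [f] would be a
    positive switching. The extension explains the length [D + 1]. *)
Lemma sign_change_walk (f : T -> R) x0 : ~ balanced adj sigma ->
  exists p, [/\ path adj x0 p, (size p <= (diam adj).+1)%N &
    f x0 * (walk_sign x0 p * f (last x0 p)) <= 0].
Proof.
move=> unb; apply: contrapT => h; apply: unb.
apply: (@positive_switching_balanced f) => x y axy.
have pos p : path adj x0 p -> (size p <= (diam adj).+1)%N ->
    0 < f x0 * (walk_sign x0 p * f (last x0 p)).
  by move=> pp sp; rewrite ltNge; apply/negP => le0; apply: h; exists p.
have [p [pp lp sp]] := walk_le_diam x0 x.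
have h1 := pos p pp (leqW sp).
have h2 : 0 < f x0 * (walk_sign x0 (rcons p y) * f (last x0 (rcons p y))).
  by apply: pos; rewrite ?rcons_path ?pp ?lp// size_rcons ltnS.
move: h1 h2; rewrite walk_sign_rcons last_rcons lp => h1 h2.
have := mulr_gt0 h1 h2.
rewrite [X in 0 < X](_ : _ = (f x0 * walk_sign x0 p) ^+ 2 * (sigma x y * (f x * f y))); last by ring.
have := sqr_ge0 (f x0 * walk_sign x0 p); set w := _ ^+ 2.
rewrite le_eqVlt => /orP[/eqP <-|w0]; first by rewrite mul0r ltxx.
by rewrite pmulr_rgt0.
Qed.

End Walks.

(** * Lower bound for the eigenvalue in terms of degree and diameter *)

Section EigenvalueBound.
Variables (R : realType) (T : finType) (adj : rel T) (sigma : T -> T -> R).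
Hypothesis adj_sym : symmetric adj.
Hypothesis sigma_sym : forall x y, sigma x y = sigma y x.
Hypothesis sigma_pm1 : forall x y, adj x y -> sigma x y = 1 \/ sigma x y = -1.
Hypothesis connected : forall x y : T, connect adj x y.
Hypothesis unbalanced : ~ balanced adj sigma.

Lemma eigenvalue_lower_bound (lam : R) f (i s : R) :
  0 <= lam -> (forall x, lapS adj sigma f x = - lam * f x) ->
  energy adj sigma f f = lam -> inner adj f f = 1 ->
  0 < s -> s ^+ 2 = 1 - i ->
  (forall x, i * lapS adj sigma f x ^+ 2 <= Gamma2S adj sigma f f x) ->
  1 <= 4 * (1 + s) * (maxdeg adj)%:R * lam *
     ((diam adj).+1%:R * (uphalf (diam adj).+1)%:R).
Proof.
move=> lam0 eig en f1 s0 s2 cd.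
have [z0 fz0] : exists z, f z != 0.
  apply: contrapT => h; have : inner adj f f = 0.
    apply: big1 => z _; suff -> : f z = 0 by rewrite !mulr0.
    by apply/eqP; apply: contrapT => /negP fz; apply: h; exists z.
  by rewrite f1 => /eqP; rewrite oner_eq0.
have [x0 _ hx0] := @Order.TotalTheory.arg_maxP _ _ _ z0 predT (fun z => f z ^+ 2) isT.
have M0 : 0 < f x0 ^+ 2.
  by apply: lt_le_trans (hx0 z0 isT); rewrite lt0r sqrf_eq0 fz0 sqr_ge0.
set M := f x0 ^+ 2 in M0.
have gb := gradient_estimate sigma_pm1 lam0 eig en s0 s2 cd (fun z => hx0 z isT).
(* [G] bounds the squared differences around any vertex; being proportional to [M], it lets [M]
   cancel at the end. *)
pose G := 2 * ((maxdeg adj)%:R * (2 * (1 + s) * lam * M)).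
have B0 : 0 <= 2 * (1 + s) * lam * M by rewrite mulr_ge0 ?(ltW M0)// mulr_ge0// mulr_ge0//; lra.
have G0 : 0 <= G by rewrite mulr_ge0// mulr_ge0// ler0n.
have hG x : 2 * ((deg adj x)%:R * GammaS adj sigma f f x) <= G.
  rewrite ler_pM2l//; apply: ler_pM => //; first exact: Gamma_ge0.
  by rewrite ler_nat; exact: (@leq_bigmax _ (deg adj) x).
have [p [pp sp chg]] := sign_change_walk adj_sym sigma_pm1 connected f x0 unbalanced.
have [q [pq rq sq lq wq]] := reduced_walk sigma_sym sigma_pm1 pp.
have h1 := walk_diff_sqr_le sigma_pm1 f pq.
have h2 := walk_energy_le adj_sym sigma_sym sigma_pm1 G0 hG pq rq.
have sD : (size q <= (diam adj).+1)%N by apply: leq_trans sq sp.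
have : M <= (diam adj).+1%:R * ((uphalf (diam adj).+1)%:R * G).
  (* By the sign change, [f x0] and the transported value have product at most 0, so their squared
     difference is at least [M]. *)
  apply: (@le_trans _ _ ((f x0 - walk_sign sigma x0 q * f (last x0 q)) ^+ 2)).
    rewrite lq wq; have := sqr_ge0 (walk_sign sigma x0 p * f (last x0 p)).
    by rewrite /M; move: chg; set w := _ * f (last _ _); nra.
  apply: (le_trans h1); apply: (@le_trans _ _ ((size q)%:R * ((uphalf (size q))%:R * G))).
    by rewrite ler_wpM2l ?ler0n.
  apply: ler_pM; [exact: ler0n|exact: mulr_ge0|by rewrite ler_nat|].
  by rewrite ler_wpM2r// ler_nat; exact: uphalf_leq.
rewrite /G => h; rewrite -(ler_pM2r M0) mul1r; apply: (le_trans h).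
by rewrite le_eqVlt; apply/orP; left; apply/eqP; ring.
Qed.

End EigenvalueBound.

(** * Explicit Euler scheme for the signed heat flow *)

Section EulerScheme.
Variables (R : realType) (T : finType) (adj : rel T) (sigma : T -> T -> R).
Hypothesis adj_sym : symmetric adj.
Hypothesis sigma_sym : forall x y, sigma x y = sigma y x.
Hypothesis sigma_pm1 : forall x y, adj x y -> sigma x y = 1 \/ sigma x y = -1.
Hypothesis deg_gt0 : forall x, (0 < deg adj x)%N.
Hypothesis Gamma2_ge0 : forall f x, 0 <= Gamma2S adj sigma f f x.

Local Notation d x := ((deg adj x)%:R : R).
Local Notation Gam := (GammaS adj sigma).
Local Notation L := (lapS adj sigma).
Local Notation energy := (energy adj sigma).
Local Notation inner := (@inner R T adj).

Definition euler (a : R) (g : T -> R) : T -> R := fun x => g x + a * L g x.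

(** For [a] in [[0, 1]] the step is a convex combination of [u x] and the average of [u] over the
    neighbours. *)
Lemma lap_step_le (u : T -> R) a c x : 0 <= a <= 1 -> (forall y, u y <= c) ->
  u x + a * lap adj u x <= c.
Proof.
move=> /andP[a0 a1] uc.
have h : lap adj u x <= c - u x.
  by apply: lap_le => [y|]; rewrite ?subr_ge0// addrC subrK.
have := uc x; nra.
Qed.

Lemma Gamma_le (g : T -> R) c x : (forall y, g y ^+ 2 <= c) -> Gam g g x <= 2 * c.
Proof.
move=> gc; have dx : 0 < d x by rewrite ltr0n.
have h : 2 * (d x * Gam g g x) <= d x * (4 * c).
  rewrite -(sum_sqr_Gamma sigma_pm1) -sum_adj_const; apply: ler_sum => y axy.
  have := gc x; have := gc y; have := sqr_ge0 (g x + g y); have := sqr_ge0 (g x - g y).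
  by case: (sigma_pm1 axy) => ->; nra.
by rewrite -(ler_pM2l dx); move: h; lra.
Qed.

Lemma euler_sqr a g x : euler a g x ^+ 2 =
  g x * g x + a * lap adj (fun z => g z * g z) x - 2 * a * Gam g g x + a ^+ 2 * L g x ^+ 2.
Proof. by rewrite /euler (lap_sqr _ sigma); ring. Qed.

Lemma Gamma_euler a g x : Gam (euler a g) (euler a g) x =
  Gam g g x + 2 * a * Gam g (L g) x + a ^+ 2 * Gam (L g) (L g) x.
Proof.
rewrite !(GammaE sigma_pm1) !(mulrCA _ 2^-1) !(mulrCA _ (d x)^-1) -!mulrDr.
congr (_ * (_ * _)); rewrite !mulr_sumr -!big_split/=.
by apply: eq_bigr => y _; rewrite /euler; ring.
Qed.

(** Discrete form of [d/dt Gam (P_t g) <= lap (Gam (P_t g))]: the discarded term is [2 * a] times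
    the nonnegative [Gamma2S g g x]. *)
Lemma Gamma_euler_le a g x : 0 <= a ->
  Gam (euler a g) (euler a g) x <=
  Gam g g x + a * lap adj (Gam g g) x + a ^+ 2 * Gam (L g) (L g) x.
Proof.
move=> a0; rewrite Gamma_euler; have := Gamma2_ge0 g x; rewrite /Gamma2S.
set A := lap _ _ _; set B := Gam g (L g) x; set C := Gam (L g) (L g) x; set D := Gam g g x.
by clearbody A B C D => h; nra.
Qed.

(** The error [a ^+ 2 * L g x ^+ 2] is at most [2 * a ^+ 2 * Gam g g x], which the dissipation
    [2 * a * Gam g g x] absorbs as [a <= 1]. *)
Lemma euler_sqr_le1 a g : 0 <= a <= 1 -> (forall x, g x ^+ 2 <= 1) ->
  forall x, euler a g x ^+ 2 <= 1.
Proof.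
move=> a01 g1 x; rewrite euler_sqr.
have h1 : g x * g x + a * lap adj (fun z => g z * g z) x <= 1.
  by apply: (@lap_step_le (fun z => g z * g z)) => // y; rewrite -expr2.
have h2 := lapS_sqr_le sigma_pm1 g x.
have h3 := Gamma_ge0 sigma_pm1 g x.
case/andP: a01 => a0 a1.
apply: le_trans h1; rewrite -addrA gerDl.
move: h2 h3; set B := L g x ^+ 2; set C := Gam g g x; clearbody B C => h2 h3.
have : a ^+ 2 * B <= a ^+ 2 * (2 * C) by rewrite ler_wpM2l ?sqr_ge0.
have : 0 <= a * (1 - a) * C by rewrite !mulr_ge0// subr_ge0.
by nra.
Qed.

Lemma iter_euler_sqr_le1 a g n : 0 <= a <= 1 -> (forall x, g x ^+ 2 <= 1) ->
  forall x, iter n (euler a) g x ^+ 2 <= 1.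
Proof. by move=> a01 g1; elim: n => //= n; apply: euler_sqr_le1. Qed.

(* Discrete form of [P_t (f^2) - (P_t f)^2 >= 2 t Gamma (P_t f)], which holds under CD(0, oo). *)
Lemma euler_Gamma_estimate a t tau n : 0 <= a <= 1 -> n%:R * a <= t ->
  (forall x, tau x ^+ 2 <= 1) ->
  forall x, iter n.+1 (euler a) tau x ^+ 2 +
    2 * a * n.+1%:R * Gam (iter n (euler a) tau) (iter n (euler a) tau) x
    <= 1 + n.+1%:R * (4 * a ^+ 2 + 16 * a ^+ 2 * t).
Proof.
move=> a01 nt tau1; case/andP: (a01) => a0 a1.
have L4 n' x : L (iter n' (euler a) tau) x ^+ 2 <= 4.
  apply: le_trans (lapS_sqr_le sigma_pm1 _ _) _.
  have := @Gamma_le (iter n' (euler a) tau) 1 x (@iter_euler_sqr_le1 _ _ n' a01 tau1).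
  by lra.
elim: n nt => [|k IH] nt x.
  rewrite /= euler_sqr.
  have h1 : tau x * tau x + a * lap adj (fun z => tau z * tau z) x <= 1.
    by apply: (@lap_step_le (fun z => tau z * tau z)) => // y; rewrite -expr2.
  have h2 : a ^+ 2 * L tau x ^+ 2 <= a ^+ 2 * 4 by rewrite ler_wpM2l ?sqr_ge0// (L4 0%N).
  have h3 : 0 <= a ^+ 2 * t by rewrite mulr_ge0 ?sqr_ge0//; move: nt; rewrite mul0r.
  move: h1 h2; set B := lap _ _ _; set C := L tau x ^+ 2; set D := Gam tau tau x; set E := tau x * tau x.
  by clearbody B C D E; lra.
have k0 : 0 <= k%:R :> R by rewrite ler0n.
have kt : k%:R * a <= t by apply: le_trans nt; rewrite ler_wpM2r// ler_nat.
rewrite iterS; set g := iter k.+1 (euler a) tau.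
have gE : g = euler a (iter k (euler a) tau) by [].
set g' := iter k (euler a) tau in gE.
rewrite euler_sqr.
(* The induction hypothesis, a bound at all vertices, survives one averaging step. Expanding the
   next square yields [- 2 * a * Gam g g x], exactly the growth of the coefficient from [k.+1] to
   [k.+2]. *)
have h1 : (g x ^+ 2 + 2 * a * k.+1%:R * Gam g' g' x) +
   a * lap adj (fun z => g z ^+ 2 + 2 * a * k.+1%:R * Gam g' g' z) x <=
   1 + k.+1%:R * (4 * a ^+ 2 + 16 * a ^+ 2 * t).
  apply: (@lap_step_le (fun z => g z ^+ 2 + 2 * a * k.+1%:R * Gam g' g' z)) => // y.
  exact: IH.
rewrite (@lap_linear _ _ _ (fun z => g z ^+ 2) (Gam g' g')) in h1.
have h2 : a ^+ 2 * L g x ^+ 2 <= a ^+ 2 * 4 by rewrite ler_wpM2l ?sqr_ge0// (L4 k.+1).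
have h3 : Gam g g x <= Gam g' g' x + a * lap adj (Gam g' g') x + a ^+ 2 * 8.
  rewrite {1 2}gE; apply: le_trans (Gamma_euler_le _ _ a0) _.
  rewrite lerD2l ler_wpM2l ?sqr_ge0//.
  by have := @Gamma_le (L g') 4 x (L4 k); lra.
have h4 : 2 * a * k.+1%:R * Gam g g x <=
   2 * a * k.+1%:R * (Gam g' g' x + a * lap adj (Gam g' g') x + a ^+ 2 * 8).
  by rewrite ler_wpM2l// mulr_ge0 ?ler0n// mulr_ge0.
have h5 : a ^+ 2 * (k.+1%:R * a) <= a ^+ 2 * t by rewrite ler_wpM2l ?sqr_ge0.
rewrite -[k.+2%:R]natr1.
move: h1 h2 h4 h5; rewrite -[lap adj (fun z => g z ^+ 2) x]/(lap adj (fun z => g z * g z) x).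
set B := lap _ _ _; set C := L g x ^+ 2; set D := Gam g g x; set E := lap _ _ _.
set F := Gam g' g' x; set n : R := k.+1%:R; set u := g x.
clearbody B C D E F n u => h1 h2 h4 h5.
nra.
Qed.

Lemma inner_euler a g f : inner (euler a g) f = inner g f - a * energy g f.
Proof.
rewrite energyC (energy_lapS adj_sym sigma_sym sigma_pm1) mulrN opprK (innerC adj f).
by rewrite /inner mulr_sumr -big_split/=; apply: eq_bigr => x _; rewrite /euler; ring.
Qed.

(** With [inner (L g) (L g) <= 2 * energy g g], a step removes at least
    [2 * a * (1 - a) * energy g g]; then [1 - z <= expR (- z)]. *)
Lemma euler_inner_decay a g lam : 0 <= a <= 1 ->
  (forall g, lam * inner g g <= energy g g) ->
  inner (euler a g) (euler a g) <= expR (- (2 * a * (1 - a) * lam)) * inner g g.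
Proof.
move=> /andP[a0 a1] ray.
rewrite (innerD adj a g (L g)).
have h1 := energy_lapS adj_sym sigma_sym sigma_pm1 g g.
have h2 := lapS_inner_le sigma_pm1 g.
have h3 := ray g.
have h4 : (1 - (2 * a * (1 - a) * lam)) * inner g g <= expR (- (2 * a * (1 - a) * lam)) * inner g g.
  by rewrite ler_wpM2r ?inner_ge0// expR_ge1Dx.
apply: le_trans h4.
have h5 : a ^+ 2 * inner (L g) (L g) <= a ^+ 2 * (2 * energy g g) by rewrite ler_wpM2l ?sqr_ge0.
have h6 : 0 <= (a * (1 - a)) * (energy g g - lam * inner g g).
  by rewrite mulr_ge0 ?subr_ge0// mulr_ge0// subr_ge0.
rewrite (_ : inner g (L g) = - energy g g); last by rewrite h1 opprK.
by move: h5 h6; set A := inner _ _; set B := energy _ _; set C := inner _ _; clearbody A B C; nra.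
Qed.

Lemma iter_euler_inner_decay a g lam n : 0 <= a <= 1 ->
  (forall g, lam * inner g g <= energy g g) ->
  inner (iter n (euler a) g) (iter n (euler a) g) <=
  expR (- (2 * a * (1 - a) * lam) * n%:R) * inner g g.
Proof.
move=> a01 ray; elim: n => [|n IH]; first by rewrite mulr0 expR0 mul1r.
apply: le_trans (euler_inner_decay _ a01 ray) _.
set c := - _; rewrite (_ : c * n.+1%:R = c + c * n%:R); last by rewrite -natr1; ring.
by rewrite expRD -mulrA ler_wpM2l ?expR_ge0.
Qed.

Lemma inner_cauchy_schwarz f g : 0 < inner g g -> inner f g ^+ 2 <= inner f f * inner g g.
Proof.
move=> g0; set V := inner g g in g0 *.
have := inner_ge0 adj (fun x => f x + (- inner f g / V) * g x).
rewrite innerD -/V => h.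
have : 0 <= V * (inner f f + 2 * (- inner f g / V) * inner f g + (- inner f g / V) ^+ 2 * V).
  by rewrite mulr_ge0// ltW.
rewrite [X in 0 <= X](_ : _ = inner f f * V - inner f g ^+ 2) ?subr_ge0//.
by field; rewrite gt_eqF.
Qed.

End EulerScheme.

(** * Volume bound by integrating the energy of the flow in time *)

Section VolumeBound.
Variables (R : realType) (T : finType) (adj : rel T) (sigma : T -> T -> R).
Hypothesis adj_sym : symmetric adj.
Hypothesis sigma_sym : forall x y, sigma x y = sigma y x.
Hypothesis sigma_pm1 : forall x y, adj x y -> sigma x y = 1 \/ sigma x y = -1.
Hypothesis deg_gt0 : forall x, (0 < deg adj x)%N.
Hypothesis Gamma2_ge0 : forall f x, 0 <= Gamma2S adj sigma f f x.
Variable b : {ffun T -> bool}.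

Local Notation Gam := (GammaS adj sigma).
Local Notation L := (lapS adj sigma).
Local Notation energy := (energy adj sigma).
Local Notation inner := (@inner R T adj).
Local Notation cost := (frust_cost adj sigma b).
Local Notation D := ((maxdeg adj)%:R : R).
Let tau x : R := sgn R (b x).

Lemma frust_cost_ge0 : 0 <= cost.
Proof.
by rewrite mulr_ge0 ?invr_ge0//; apply: sumr_ge0 => x _; apply: sumr_ge0.
Qed.

Lemma sgn_sqr x : tau x ^+ 2 = 1.
Proof. by rewrite /tau /sgn; case: (b x); rewrite ?sqrrN expr1n. Qed.

Lemma inner_sgn : inner tau tau = vol R adj.
Proof. by apply: eq_bigr => x _; rewrite -expr2 sgn_sqr mulr1. Qed.

Lemma energy_le_cost B (g : T -> R) :
  (forall x y, adj x y -> `|g x - sigma x y * g y| <= B) -> energy g tau <= B * cost.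
Proof.
move=> gB; rewrite /energy /frust_cost mulrCA ler_wpM2l ?invr_ge0//.
rewrite mulr_sumr; apply: ler_sum => x _; rewrite mulr_sumr; apply: ler_sum => y axy.
by apply: le_trans (ler_norm _) _; rewrite normrM ler_wpM2r// gB.
Qed.

(** A squared edge difference is at most [2 * D * Gam], and [2 * a * n.+1%:R * Gam] is at most 1
    plus the accumulated error [del]. *)
Lemma edge_diff_le a t m n : 0 < a -> a <= 1 -> m%:R * a = t -> (n < m)%N ->
  forall x y, adj x y ->
  `|iter n (euler adj sigma a) tau x - sigma x y * iter n (euler adj sigma a) tau y|
   <= Num.sqrt (D * (1 + m%:R * (4 * a ^+ 2 + 16 * a ^+ 2 * t)) / a) / Num.sqrt n.+1%:R.
Proof.
move=> a0 a1 mt nm x y axy.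
set del := m%:R * _.
have a01 : 0 <= a <= 1 by rewrite a1 ltW.
have t0 : 0 <= t by rewrite -mt mulr_ge0 ?ler0n// ltW.
have nt : n%:R * a <= t by rewrite -mt ler_wpM2r ?ltW// ltr_nat.
have tau1 z : tau z ^+ 2 <= 1 by rewrite sgn_sqr.
have := euler_Gamma_estimate sigma_pm1 deg_gt0 Gamma2_ge0 a01 nt tau1 x.
set g := iter n (euler adj sigma a) tau; set h := iter n.+1 _ _.
have eps0 : 0 <= 4 * a ^+ 2 + 16 * a ^+ 2 * t.
  by rewrite addr_ge0// mulr_ge0 ?sqr_ge0// mulr_ge0 ?sqr_ge0.
have : n.+1%:R * (4 * a ^+ 2 + 16 * a ^+ 2 * t) <= del by rewrite ler_wpM2r ?ler_nat.
have := sqr_ge0 (h x) => h0 h1 h2.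
have G0 : 2 * a * n.+1%:R * Gam g g x <= 1 + del.
  by move: h0 h1 h2; set u := _ ^+ 2; set w := n.+1%:R * _; lra.
have n0 : 0 < n.+1%:R :> R by rewrite ltr0n.
have del0 : 0 <= del by rewrite mulr_ge0 ?ler0n.
have D0 : 0 <= D by rewrite ler0n.
rewrite -sqrtrV ?ler0n// -sqrtrM; last first.
  by rewrite divr_ge0 ?(ltW a0)// mulr_ge0// addr_ge0.
rewrite -sqrtr_sqr ler_wsqrtr//.
apply: le_trans (sqr_diff_Gamma sigma_pm1 _ axy) _.
apply: (@le_trans _ _ (2 * (D * Gam g g x))).
  rewrite ler_wpM2l// ler_wpM2r ?Gamma_ge0// ler_nat.
  exact: (@leq_bigmax _ (deg adj) x).
rewrite ler_pdivlMr// ler_pdivlMr//.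
rewrite (_ : _ * a = D * (2 * a * n.+1%:R * Gam g g x)); last by ring.
by rewrite ler_wpM2l.
Qed.

(** Each step loses [a] times the energy, and the bounds proportional to [1 / sqrt k] sum to at most
    [2 * sqrt n]. *)
Lemma mass_loss a t m n : 0 < a -> a <= 1 -> m%:R * a = t -> (n <= m)%N ->
  vol R adj - inner (iter n (euler adj sigma a) tau) tau <=
  2 * (a * Num.sqrt (D * (1 + m%:R * (4 * a ^+ 2 + 16 * a ^+ 2 * t)) / a) * cost) * Num.sqrt n%:R.
Proof.
move=> a0 a1 mt; set c := Num.sqrt (_ / a).
elim: n => [|n IH] nm; first by rewrite inner_sgn subrr sqrtr0 mulr0.
have := IH (ltnW nm); rewrite iterS inner_euler//.
set g := iter n _ _.
have := energy_le_cost (edge_diff_le a0 a1 mt nm); rewrite -/c -/g => e1.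
have c0 : 0 <= c by rewrite sqrtr_ge0.
set s := Num.sqrt n%:R; set s' := Num.sqrt n.+1%:R in e1 *.
have s0 : 0 <= s by rewrite sqrtr_ge0.
have s'0 : 0 < s' by rewrite sqrtr_gt0.
have ss : s' ^+ 2 = s ^+ 2 + 1 by rewrite !sqr_sqrtr ?ler0n// natr1.
(* Since [s' ^+ 2 - s ^+ 2 = 1], one has [2 * s' * (s' - s) = 1 + (s' - s) ^+ 2]. *)
have step : s'^-1 <= 2 * (s' - s).
  rewrite -(ler_pM2r s'0) mulVf ?gt_eqF//.
  by have := sqr_ge0 (s' - s); clearbody s s'; nra.
have k0 : 0 <= a * c * cost by rewrite mulr_ge0 ?frust_cost_ge0// mulr_ge0// ltW.
have e2 : a * energy g tau <= a * (c / s' * cost) by rewrite ler_wpM2l// ltW.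
have e3 : (a * c * cost) * s'^-1 <= (a * c * cost) * (2 * (s' - s)) by rewrite ler_wpM2l.
have e4 : a * (c / s' * cost) = (a * c * cost) * s'^-1 by ring.
move: e2 e3; rewrite e4; set A := a * c * cost.
set P := inner g tau; set Q := a * energy g tau; set X := A / s'.
by clearbody A P Q X; lra.
Qed.

Lemma half_volume lam : 0 < lam -> (0 < #|T|)%N ->
  (forall g, lam * inner g g <= energy g g) ->
  vol R adj <= 4 * cost * Num.sqrt (D * (ln 2 / lam)).
Proof.
move=> lam0 T0 ray; set t := ln 2 / lam; set V := vol R adj.
have ln0 : 0 < ln 2 :> R by rewrite ln_gt0// ltr1n.
have t0 : 0 < t by rewrite divr_gt0.
have V0 : 0 < V.
  have /card_gt0P[x0 _] := T0.
  rewrite /V /vol (bigD1 x0)//= ltr_pwDl ?ltr0n//.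
  by apply: sumr_ge0 => x _; rewrite ler0n.
set B := 2 * cost * Num.sqrt (D * t).
have B0 : 0 <= B by rewrite mulr_ge0 ?sqrtr_ge0// mulr_ge0 ?frust_cost_ge0.
(* [C] is [m] times the total error, independent of [m]: its terms come from [del] and from the
   factor [1 - a] in the decay rate. *)
pose C := B * (4 * t ^+ 2 + 16 * t ^+ 3) + V * (t * ln 2).
suff main m : (0 < m)%N -> t <= m%:R -> t * ln 2 <= m%:R -> (V / 2 - B) * m%:R <= C.
  suff : V / 2 - B <= 0 by rewrite /B; lra.
  rewrite leNgt; apply/negP => X0.
  (* The limit in [m] becomes an Archimedean choice: this [m] meets both size conditions and exceeds
     [C / (V / 2 - B)]. *)
  pose m := (Num.truncn (t + t * ln 2 + C / (V / 2 - B))).+1.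
  have tl0 : 0 < t * ln 2 by rewrite mulr_gt0.
  have t3 : 0 <= t ^+ 3 by rewrite exprn_ge0// ltW.
  have C0 : 0 <= C.
    apply: addr_ge0; last by rewrite mulr_ge0// ltW.
    by apply: mulr_ge0 => //; rewrite addr_ge0// mulr_ge0// sqr_ge0.
  have q0 : 0 <= C / (V / 2 - B) by rewrite divr_ge0// ltW.
  have mbig : t + t * ln 2 + C / (V / 2 - B) < m%:R by rewrite truncnS_gt.
  have h : (V / 2 - B) * m%:R <= C by apply: main => //; lra.
  have : C / (V / 2 - B) < m%:R by lra.
  by rewrite ltr_pdivrMr// mulrC ltNge h.
move=> m0 tm lm.
have mR : 0 < m%:R :> R by rewrite ltr0n.
pose a := t / m%:R.
have a0 : 0 < a by rewrite divr_gt0.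
have a1 : a <= 1 by rewrite ler_pdivrMr// mul1r.
have mt : m%:R * a = t by rewrite mulrC divfK// gt_eqF.
have loss := mass_loss a0 a1 mt (leqnn m).
set del := m%:R * (4 * a ^+ 2 + 16 * a ^+ 2 * t) in loss.
have delE : del * m%:R = 4 * t ^+ 2 + 16 * t ^+ 3 by rewrite /del -mt; ring.
have del0 : 0 <= del.
  rewrite mulr_ge0 ?ler0n// addr_ge0// mulr_ge0 ?sqr_ge0// ?(ltW t0)//.
  by rewrite mulr_ge0// sqr_ge0.
set g := iter m _ tau in loss.
have loss' : V - inner g tau <= B * (1 + del).
  apply: (le_trans loss).
  have -> : 2 * (a * Num.sqrt (D * (1 + del) / a) * cost) * Num.sqrt m%:R =
     2 * cost * (a * Num.sqrt (D * (1 + del) / a) * Num.sqrt m%:R) by ring.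
  rewrite /B -[leRHS]mulrA; apply: ler_wpM2l; first by rewrite mulr_ge0 ?frust_cost_ge0.
  have -> : a * Num.sqrt (D * (1 + del) / a) * Num.sqrt m%:R = Num.sqrt (D * t) * Num.sqrt (1 + del).
    have Dd : 0 <= D * (1 + del) by rewrite mulr_ge0 ?ler0n// addr_ge0.
    have aE : a = Num.sqrt (a ^+ 2) by rewrite sqrtr_sqr ger0_norm// ltW.
    rewrite {1}aE -(sqrtrM (1 + del)); last by rewrite mulr_ge0 ?ler0n// ltW.
    rewrite -(sqrtrM (D * (1 + del) / a)) ?sqr_ge0// -(sqrtrM m%:R); last first.
      by rewrite mulr_ge0 ?sqr_ge0// divr_ge0// ltW.
    by congr Num.sqrt; rewrite -mt; field; rewrite gt_eqF.
  rewrite ler_wpM2l ?sqrtr_ge0//.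
  rewrite -[leRHS]ger0_norm; last by rewrite addr_ge0.
  by rewrite -sqrtr_sqr ler_wsqrtr// expr2 ler_peMr ?addr_ge0// lerDl.
(* At [t = ln 2 / lam] the decay exponent is [- 2 * (ln 2 - y)], so [inner g tau] is halved up to
   the factor [expR y]. *)
pose y := a * ln 2.
have y0 : 0 <= y by rewrite mulr_ge0// ltW.
have yE : y * m%:R = t * ln 2 by rewrite /y -mt; ring.
have y1 : y <= 1 by rewrite -(ler_pM2r mR) yE mul1r.
have dec : inner g tau <= expR y / 2 * V.
  have E : expR (- (2 * a * (1 - a) * lam) * m%:R) = (expR y / 2) ^+ 2.
    rewrite -[in RHS](@lnK _ 2) ?posrE// -expRN -expRD -expRM_natl.
    congr expR; rewrite /y /a /t; field; rewrite !gt_eqF//.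
  have a01 : 0 <= a <= 1 by rewrite a1 ltW.
  have := iter_euler_inner_decay adj_sym sigma_sym sigma_pm1 tau m a01 ray.
  rewrite inner_sgn E -/V -/g => h1.
  have h2 : inner g tau ^+ 2 <= (expR y / 2 * V) ^+ 2.
    apply: le_trans (inner_cauchy_schwarz _ _) _; first by rewrite inner_sgn.
    by rewrite inner_sgn -/V exprMn expr2 [V ^+ 2]expr2 mulrA ler_wpM2r ?(ltW V0)// -expr2.
  apply: le_trans (ler_norm _) _.
  have w0 : 0 <= expR y / 2 * V by rewrite mulr_ge0 ?(ltW V0)// divr_ge0// expR_ge0.
  by rewrite -(ger0_norm w0) -!sqrtr_sqr ler_wsqrtr.
have ey : (1 - y) * expR y <= 1.
  apply: (@le_trans _ _ (expR (- y) * expR y)).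
    by rewrite ler_wpM2r ?expR_ge0// expR_ge1Dx.
  by rewrite -expRD addNr expR0.
have V2 : V / 2 <= B * (1 + del) + y * V.
  have h1 : V - B * (1 + del) <= expR y / 2 * V by lra.
  have y1' : 0 <= 1 - y by rewrite subr_ge0.
  (* Multiplying by [1 - y] removes the exponential, since [(1 - y) * expR y <= 1], at the cost of
     [y * V]. *)
  have h2 := ler_wpM2l y1' h1.
  have h3 : (1 - y) * (expR y / 2 * V) <= V / 2.
    rewrite (_ : (1 - y) * _ = (1 - y) * expR y * (V / 2)); last by ring.
    by rewrite ler_piMl// divr_ge0// ltW.
  have h4 : 0 <= y * (B * (1 + del)) by rewrite mulr_ge0// mulr_ge0// addr_ge0.
  by move: h2 h3 h4; set W := B * (1 + del); set Z := expR y / 2 * V; nra.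
have := ler_wpM2r (ltW mR) V2.
rewrite /C -delE -yE; lra.
Qed.

End VolumeBound.

(** * Degenerate cases, constants attached to [N], and the final estimate *)

(** By connectedness, an isolated vertex would be the whole graph, which has no cycle and is
    therefore balanced. *)
Lemma unbalanced_deg_gt0 (R : realType) (T : finType) (adj : rel T) (sigma : T -> T -> R) :
  (forall x y : T, connect adj x y) -> ~ balanced adj sigma ->
  forall x, (0 < deg adj x)%N.
Proof.
move=> conn unb x; rewrite lt0n; apply/negP => /eqP/cards0_eq d0; apply: unb.
have noadj y : adj x y = false by have := in_set0 y; rewrite -d0 inE.
have xy y : y = x.
  have /connectP[[|z p] /=] := conn x y; first by [].
  by rewrite noadj.
by move=> [|z [|w p]]//=; rewrite (xy z) noadj.
Qed.

Lemma invN_ge0 (R : realType) (N : \bar R) : (1%:E < N)%E -> 0 <= invN N.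
Proof.
by case: N => [n| |]//=; rewrite lte_fin invr_ge0 => n1; apply: ltW; apply: lt_trans n1.
Qed.

Lemma sqrtfac_gt0 (R : realType) (N : \bar R) : (1%:E < N)%E -> 0 < sqrtfac N.
Proof.
case: N => [n| |]//=; rewrite lte_fin sqrtr_gt0 => n1.
by rewrite divr_gt0 ?subr_gt0//; apply: lt_trans n1.
Qed.

(** Makes [sqrtfac N] an admissible [s] in the gradient estimate with [i = invN N], including [N]
    infinite. *)
Lemma sqrtfac_sqr (R : realType) (N : \bar R) : (1%:E < N)%E ->
  sqrtfac N ^+ 2 = 1 - invN N.
Proof.
case: N => [n| |]//=; rewrite ?lte_fin => n1; last by rewrite expr1n subr0.
have n0 : 0 < n by apply: lt_trans n1.
rewrite sqr_sqrtr; last by rewrite divr_ge0 ?subr_ge0// ltW.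
by field; rewrite gt_eqF.
Qed.

Lemma uphalf_le_ceil (R : realType) (n : nat) :
  (uphalf n)%:R <= (Num.ceil (n%:R / 2 : R))%:~R :> R.
Proof.
rewrite -[(uphalf n)%:R]/((uphalf n)%:~R : R) ler_int -ltzD1 -ltrBlDr ceil_gt_int intrB.
have h : (uphalf n * 2 <= n + 1)%N.
  rewrite muln2 uphalf_half doubleD -{3}(odd_double_half n) addnAC leq_add2r.
  by case: odd.
by move: h; rewrite -(ler_nat R) natrM natrD -[(uphalf n)%:R]/((uphalf n)%:~R : R); lra.
Qed.

Unset Implicit Arguments. Set Strict Implicit. Set Printing Implicit Defensive.

Theorem theorem3p12 (R : realType) (T : finType) (adj : rel T)
    (sigma : T -> T -> R) (N : \bar R)
    (adj_sym : symmetric adj) (adj_irr : irreflexive adj)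
    (connected : forall x y : T, connect adj x y)
    (sigma_sym : forall x y : T, sigma x y = sigma y x)
    (sigma_pm1 : forall x y : T, adj x y -> sigma x y = 1 \/ sigma x y = -1)
    (unbalanced : ~ balanced adj sigma)
    (N_gt1 : (1%:E < N)%E)
    (curv : CD adj sigma 0 N) :
  vol R adj <=
    8 * Num.sqrt ((1 + sqrtfac N) * ln 2) * (maxdeg adj)%:R
      * frustration adj sigma
      * Num.sqrt ((diam adj).+1%:R * (Num.ceil ((diam adj).+1%:R / 2 : R))%:~R).
Proof.
have dg := unbalanced_deg_gt0 connected unbalanced.
have [x0] : exists x0 : T, True.
  by apply: contrapT => h; apply: unbalanced => -[|x s] //; case: h; exists x.
move=> _.
have T0 : (0 < #|T|)%N by apply/card_gt0P; exists x0.
have N0 := invN_ge0 N_gt1.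
have cd f x : invN N * lapS adj sigma f x ^+ 2 <= Gamma2S adj sigma f f x.
  by have := curv f x; rewrite mul0r addr0.
have G2 f x : 0 <= Gamma2S adj sigma f f x.
  by apply: le_trans (cd f x); rewrite mulr_ge0 ?sqr_ge0.
have s0 := sqrtfac_gt0 N_gt1.
have [lam [f [f1 eig en ray]]] := ground_state adj_sym sigma_sym sigma_pm1 dg x0.
have lam0 : 0 <= lam by rewrite -en energy_ge0.
have eb := eigenvalue_lower_bound adj_sym sigma_sym sigma_pm1 connected unbalanced
  lam0 eig en f1 s0 (sqrtfac_sqr N_gt1) (cd f).
move: eb; set s := sqrtfac N in s0 *; set D : R := (maxdeg adj)%:R.
set n := (diam adj).+1; set K : R := n%:R * (Num.ceil (n%:R / 2 : R))%:~R => eb.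
have D0 : 0 <= D by rewrite ler0n.
have ln0 : 0 < ln 2 :> R by rewrite ln_gt0// ltr1n.
have K0 : 0 <= K.
  by rewrite mulr_ge0 ?ler0n//; apply: le_trans (uphalf_le_ceil _ n); rewrite ler0n.
have eb' : 1 <= 4 * (1 + s) * D * lam * K.
  apply: (le_trans eb); rewrite ler_wpM2l//.
    by rewrite mulr_ge0// mulr_ge0// mulr_ge0//; lra.
  by rewrite ler_wpM2l ?ler0n// uphalf_le_ceil.
have lamp : 0 < lam.
  rewrite lt0r lam0 andbT; apply/eqP => l0.
  by move: eb'; rewrite l0 mulr0 mul0r ler10.
have key b : vol R adj <= 8 * Num.sqrt ((1 + s) * ln 2) * D * Num.sqrt K * frust_cost adj sigma b.
  have := half_volume adj_sym sigma_sym sigma_pm1 dg G2 b lamp T0 ray.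
  move=> h; apply: (le_trans h); rewrite -/D.
  rewrite mulrAC ler_wpM2r ?frust_cost_ge0//.
  have -> : 8 * Num.sqrt ((1 + s) * ln 2) * D * Num.sqrt K =
    4 * (2 * D * (Num.sqrt ((1 + s) * ln 2) * Num.sqrt K)) by ring.
  rewrite ler_wpM2l//.
  have sl : 0 <= (1 + s) * ln 2 by rewrite mulr_ge0 ?(ltW ln0)//; lra.
  have D2 : 2 * D = Num.sqrt ((2 * D) ^+ 2) by rewrite sqrtr_sqr ger0_norm// mulr_ge0.
  rewrite -(sqrtrM K sl) D2 -(sqrtrM _ (sqr_ge0 (2 * D))) ler_wsqrtr//.
  (* Multiplying [D * ln 2] by the eigenvalue bound [eb'] produces [(2 * D) ^+ 2 * ((1 + s) * ln 2)
     * K * lam]. *)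
  rewrite mulrA ler_pdivrMr//.
  have Dl : 0 <= D * ln 2 by rewrite mulr_ge0// ltW.
  have := ler_wpM2l Dl eb'; rewrite mulr1 => h2; apply: (le_trans h2).
  by rewrite le_eqVlt; apply/orP; left; apply/eqP; ring.
rewrite (mulrAC _ (frustration _ _)) /frustration.
(* The bound holds for the cost of every switching, and a minimum of two values is one of them. *)
by elim/big_ind: _ => // u v hu hv; rewrite /Num.min; case: ifP.
Qed.
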